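(* Let $\{S_i\}_{i=1}^m$ be an IFS of similitudes $S_i(x)=rR_ix+d_i$ on $\mathbb R^d$ with common ratio $r\in(0,1)$ and self-similar set $K$, satisfying condition (H), and assume that the corresponding augmented tree $(X,\mathcal E)$ (with respect to a bounded closed invariant set $J$) is simple. Then there exists a bijection $\Phi:\partial X\to K$ satisfying the H\''older equivalence property $$C^{-1}|\Phi(\xi)-\Phi(\eta)|\le\rho_a(\xi,\eta)^\alpha\le C|\Phi(\xi)-\Phi(\eta)|\qquad\forall\,\xi,\eta\in\partial X,$$ where $\alpha=-\log r/a$ and $C>0$ is a constant.
   Context: IFS: $S_i(x)=rR_ix+d_i$, $0<r<1$, $R_i$ orthogonal, $d_i\in\mathbb R^d$; $K$ is the nonempty compact set with $K=\bigcup_iS_i(K)$. $\Sigma=\{1,\dots,m\}$, $X=\bigcup_{n\ge0}\Sigma^n$, $\Sigma^0=\{o\}$ (empty word, root); $S_{\mathbf u}=S_{i_1}\circ\cdots\circ S_{i_n}$, $K_{\mathbf u}=S_{\mathbf u}(K)$ for $\mathbf u=i_1\cdots i_n$. Condition (H): there is $c>0$ such that for all $n\ge1$ and $\mathbf u,\mathbf v\in\Sigma^n$, $K_{\mathbf u}\cap K_{\mathbf v}=\emptyset$ implies $\mathrm{dist}(K_{\mathbf u},K_{\mathbf v})\ge cr^n$. Augmented tree: $J\subset\mathbb R^d$ is a fixed nonempty bounded closed set with $S_i(J)\subset J$ for all $i$; $J_{\mathbf u}=S_{\mathbf u}(J)$. $\mathcal E=\mathcal E_v\cup\mathcal E_h$;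 $\mathcal E_v$: (vertical) edges joining $\mathbf u$ and $\mathbf ui$; $\mathcal E_h$ (horizontal edges): pairs $(\mathbf u,\mathbf v)$, $\mathbf u\ne\mathbf v$ in the same level $\Sigma^n$, with $J_{\mathbf u}\cap J_{\mathbf v}\ne\emptyset$. Simple: a horizontal connected component is a maximal connected horizontal subgraph $T$ of some level $\Sigma^n$. $T\Sigma=\{\mathbf ui:\mathbf u\in T,i\in\Sigma\}$. $T\sim T'$ if there is a bijection $g:T\cup T\Sigma\to T'\cup T'\Sigma$ (as subgraphs of $X$) such that $g,g^{-1}$ preserve vertical and horizontal edges. $X$ is simple if there are finitely many equivalence classes of horizontal connected components. A simple augmented tree is hyperbolic. Hyperbolic boundary: with graph distance $d(\cdot,\cdot)$, $|x|=d(o,x)$, $|x\wedge y|=\frac12(|x|+|y|-d(x,y))$, the graph is hyperbolic if for some $\delta>0$, $|x\wedge y|\ge\min\{|x\wedge z|,|z\wedge y|\}-\delta$ for all $x,y,z$. For fixed $a>0$ with $e^{\delta a}-1<\sqrt2-1$, put $\rho_a(x,y)=e^{-a|x\wedge y|}$ if $x\ne y$ and $0$ if $x=y$; it is comparable up to multiplicative constants to the metric $\theta_a(x,y)=\inf\{\sum_{i=1}^n\rho_a(x_{i-1},x_i):n\ge1,\ x_0=x,\ x_n=y\}$. $\partial X=\hat X\setminus X$, $\hat X$ the completion of $X$ under $\rho_a$ (equivalently $\theta_a$), with $\rho_a$ extended to $\partial X$. *)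

(* Defs.v *)
From HB Require Import structures.
From mathcomp Require Import all_boot all_order all_algebra.
From mathcomp Require Import all_classical all_reals all_analysis.

Set Implicit Arguments.
Unset Strict Implicit.
Unset Printing Implicit Defensive.

Import Order.TTheory GRing.Theory Num.Theory.
Import numFieldNormedType.Exports.

Local Open Scope classical_set_scope.
Local Open Scope ring_scope.

Section Euclidean.
Context {R : realType} {d : nat}.
Implicit Types (x : 'cV[R]_d) (A B : set 'cV[R]_d).

(* The library norm on matrices is the sup norm; the topology of ['cV[R]_d]
   and its bounded sets are the same for both norms. *)
Definition enorm x : R := Num.sqrt (\sum_(i < d) x i 0 ^+ 2).

Definition setdist A B : R :=
  inf [set enorm (x.1 - x.2) | x in A `*` B].

End Euclidean.

(* The word [i_1 ... i_n] is the list [:: i_1; ...; i_n]; the root is [::] and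
   the level [Sigma^n] consists of the words of size [n]. *)
Notation word m := (seq 'I_m).

Section IFS.
Context {R : realType} {d m : nat}.
Variable S : 'I_m -> 'cV[R]_d -> 'cV[R]_d.
Implicit Types (u v : word m) (A K J : set 'cV[R]_d).

(* [i_1 ... i_n] acts as [S i_1 \o ... \o S i_n]. *)
Definition Sword u (x : 'cV[R]_d) : 'cV[R]_d := foldr S x u.

Definition cell A u : set 'cV[R]_d := Sword u @` A.

Definition self_similar_set K : Prop :=
  [/\ K !=set0, compact K & K = \bigcup_(i : 'I_m) (S i @` K)].

Definition condH (r : R) K : Prop :=
  exists2 c : R, 0 < c &
    forall n u v, (1 <= n)%N -> size u = n -> size v = n ->
      cell K u `&` cell K v = set0 ->
      c * r ^+ n <= setdist (cell K u) (cell K v).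

Definition bounded_closed_invariant J : Prop :=
  [/\ J !=set0, bounded_set J, closed J & forall i, S i @` J `<=` J].

Definition vedge u v : bool :=
  [exists i, v == rcons u i] || [exists i, u == rcons v i].

Definition hedge J u v : bool :=
  [&& u != v, size u == size v & `[< cell J u `&` cell J v !=set0 >]].

Definition edge J u v : bool := vedge u v || hedge J u v.

End IFS.

Section Graph.
Context {R : realType} {m : nat}.
Variable E : rel (word m).
Implicit Types (u v x y z : word m) (a delta : R).

(* The length of a path [x :: p] is [size p]. *)
Definition gdist x y : R :=
  inf [set (size p)%:R | p in [set p : seq (word m) | path E x p /\ last x p = y]].

Definition height x : R := gdist [::] x.

Definition gromov x y : R := (height x + height y - gdist x y) / 2.

Definition hyperbolic delta : Prop :=
  0 < delta /\
  forall x y z, Num.min (gromov x z) (gromov z y) - delta <= gromov x y.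

Definition rho a x y : R := if x == y then 0 else expR (- a * gromov x y).

(* The completion of the vertex set under [rho a]: its points are the classes
   of [rho a]-Cauchy sequences [x], [y] with [rho a (x n) (y n)] tending to 0,
   and a vertex is identified with the class of its constant sequence. *)
Definition rho_cauchy a (x : nat -> word m) : Prop :=
  forall e : R, 0 < e -> exists N : nat, forall i j : nat,
    (N <= i)%N -> (N <= j)%N -> rho a (x i) (x j) < e.

Definition cauchy_class a (x : nat -> word m) : set (nat -> word m) :=
  [set y | rho_cauchy a y /\ (fun n => rho a (x n) (y n)) @ \oo --> (0 : R)].

Definition completion a : set (set (nat -> word m)) :=
  [set cauchy_class a x | x in [set x | rho_cauchy a x]].

Definition boundary a : set (set (nat -> word m)) :=
  completion a `\` [set cauchy_class a (fun=> u) | u in [set: word m]].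

(* [rho a] need not be continuous, so its extension to the boundary is taken
   to be [exp (- a |xi /\ eta|)], where [|xi /\ eta|] is the infimum of
   [liminf |x n /\ y n|] over all representatives [x], [y] of [xi], [eta]. *)
Definition rho_bd a (xi eta : set (nat -> word m)) : R :=
  sup [set limn_sup (fun n => rho a (z.1 n) (z.2 n)) | z in xi `*` eta].

End Graph.

Section Simple.
Context {m : nat}.
Variables (V H : rel (word m)).
Implicit Types (T : set (word m)).

Definition connected_in T : Prop :=
  forall u v, T u -> T v ->
    exists p : seq (word m),
      [/\ path H u p, last u p = v & forall w, w \in p -> T w].

Definition connected_level_part (n : nat) T : Prop :=
  [/\ T !=set0, forall u, T u -> size u = n & connected_in T].

Definition hcomponent T : Prop :=
  exists n : nat, connected_level_part n T /\
    forall T', connected_level_part n T' -> T `<=` T' -> T' = T.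

Definition offspring T : set (word m) :=
  [set rcons x.1 x.2 | x in T `*` [set: 'I_m]].

Definition hequiv T T' : Prop :=
  exists g : word m -> word m,
    set_bij (T `|` offspring T) (T' `|` offspring T') g /\
    forall u v, (T `|` offspring T) u -> (T `|` offspring T) v ->
      V (g u) (g v) = V u v /\ H (g u) (g v) = H u v.

Definition hequiv_class T : set (set (word m)) :=
  [set T' | hcomponent T' /\ hequiv T T'].

Definition simple_tree : Prop :=
  finite_set [set hequiv_class T | T in hcomponent].

End Simple.

(* Main.v *)
Require Import Defs.
From HB Require Import structures.
From mathcomp Require Import all_boot all_order all_algebra.
From mathcomp Require Import all_classical all_reals all_analysis.
From mathcomp Require Import ring lra zify.

(** A simple augmented tree is, up to bounded errors, the tree of its horizontal
components, and its boundary is the boundary of that tree.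

Equivalent components have the same number of vertices, so by simplicity there
are at most [N] vertices in each horizontal component.  Let [k] be the last
level at which the truncations of two vertices [x], [y] lie in the same
component.  A path from [x] to [y] that avoided all levels [<= k] would project
to a horizontal path at level [k.+1], hence the Gromov product of [x] and [y] is
at most [k]; going through the component at level [k] shows that it is at least
[k - N / 2].  Consequently [rho a x y `^ (- ln r / a)], which equals [r] to the
power of the Gromov product, is comparable with [r ^+ k]
([confluence_level], [gromov_ge_level], [rho_powR]).

Fix a point [p] of [K] and send a vertex [x] to [Sword S x p].  At level [k] the
cells of [J] over the component of [x] and [y] form a chain of at most [N] cells
of diameter comparable with [r ^+ k], and [K] is contained in [J]; at level
[k.+1] the cells of [J], hence those of [K], are disjoint, and condition (H)
separates them by a multiple of [r ^+ k].  This gives [rho_comparison]: the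
distance of the images is at most a constant times [rho a x y `^ (- ln r / a)],
which in turn is at most a constant times the distance of the images plus
[r ^+ size x + r ^+ size y].

The last two terms vanish at the boundary.  A Cauchy sequence that does not
represent a vertex leaves every finite level, because vertices are isolated
([boundary_representative]).  So the map of vertices extends to boundary points
as the limit along any representative ([bd_mapP]), the two inequalities pass to
the limit ([bd_map_dist_le], [rho_bd_le_dist]), and they imply injectivity.  For
surjectivity, each point of [K] lies in a cell of every level, and the second
inequality makes the corresponding sequence of words a Cauchy sequence
([bd_map_surj]). *)

Set Implicit Arguments.
Unset Strict Implicit.
Unset Printing Implicit Defensive.

Import Order.TTheory GRing.Theory Num.Theory.
Import numFieldNormedType.Exports.

Local Open Scope classical_set_scope.
Local Open Scope ring_scope.

(** * Euclidean norm *)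

Section EuclideanNorm.
Context {R : realType} {d : nat}.
Implicit Types x y z : 'cV[R]_d.

Lemma enorm_ge0 x : 0 <= enorm x.
Proof. exact: sqrtr_ge0. Qed.

Lemma enorm_sqr x : enorm x ^+ 2 = \sum_(i < d) x i 0 ^+ 2.
Proof. by rewrite sqr_sqrtr// sumr_ge0// => i _; rewrite sqr_ge0. Qed.

Lemma abs_coord_le_enorm x i : `|x i 0| <= enorm x.
Proof.
rewrite -(@ler_pXn2r _ 2)// ?nnegrE ?enorm_ge0// enorm_sqr (bigD1 i)//=.
by rewrite real_normK ?num_real// lerDl sumr_ge0// => j _; rewrite sqr_ge0.
Qed.

Lemma enorm0_eq0 x : enorm x = 0 -> x = 0.
Proof.
move=> x0; apply/matrixP => i j; rewrite (ord1 j) mxE; apply/eqP.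
by rewrite -normr_le0 -x0 abs_coord_le_enorm.
Qed.

Lemma enorm0 : enorm (0 : 'cV[R]_d) = 0.
Proof.
by rewrite /enorm big1 ?sqrtr0// => i _; rewrite mxE expr0n.
Qed.

Lemma enormN x : enorm (- x) = enorm x.
Proof. by congr Num.sqrt; apply: eq_bigr => i _; rewrite mxE sqrrN. Qed.

Lemma enormBC x y : enorm (x - y) = enorm (y - x).
Proof. by rewrite -enormN opprB. Qed.

Lemma enormZ (k : R) x : 0 <= k -> enorm (k *: x) = k * enorm x.
Proof.
move=> k0; apply/eqP; rewrite -(@eqrXn2 _ 2)// ?mulr_ge0 ?enorm_ge0//.
rewrite exprMn !enorm_sqr mulr_sumr; apply/eqP.
by apply: eq_bigr => i _; rewrite mxE exprMn.
Qed.

Lemma enorm_orthogonal (Q : 'M[R]_d) x : Q^T *m Q = 1%:M ->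
  enorm (Q *m x) = enorm x.
Proof.
have sq (y : 'cV[R]_d) : \sum_(i < d) y i 0 ^+ 2 = (y^T *m y) 0 0.
  by rewrite mxE; apply: eq_bigr => i _; rewrite mxE expr2.
by move=> QQ; congr Num.sqrt; rewrite !sq trmx_mul -mulmxA (mulmxA Q^T) QQ mul1mx.
Qed.

(** Expanding the sum of the squares of [|y| x i - |x| y i] gives
[2 |x| |y| (|x| |y| - <x, y>)], which is therefore nonnegative. *)
Lemma cauchy_schwarz x y : \sum_(i < d) x i 0 * y i 0 <= enorm x * enorm y.
Proof.
have [x0|x_neq0] := eqVneq (enorm x) 0.
  by rewrite x0 mul0r (enorm0_eq0 x0) big1// => i _; rewrite mxE mul0r.
have [y0|y_neq0] := eqVneq (enorm y) 0.
  by rewrite y0 mulr0 (enorm0_eq0 y0) big1// => i _; rewrite mxE mulr0.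
have p : 0 < enorm x * enorm y.
  by rewrite mulr_gt0// lt_def ?x_neq0 ?y_neq0 enorm_ge0.
have : 0 <= \sum_(i < d) (enorm y * x i 0 - enorm x * y i 0) ^+ 2.
  by rewrite sumr_ge0// => i _; rewrite sqr_ge0.
rewrite (_ : \sum_(i < d) _ = (enorm x * enorm y) *+ 2 *
   (enorm x * enorm y - \sum_(i < d) x i 0 * y i 0)); last first.
  rewrite (eq_bigr (fun i => enorm y ^+ 2 * x i 0 ^+ 2
    + enorm x ^+ 2 * y i 0 ^+ 2 - (enorm x * enorm y) *+ 2 * (x i 0 * y i 0))).
    by rewrite sumrB big_split/= -!mulr_sumr -!enorm_sqr; ring.
  by move=> i _; ring.
by rewrite pmulr_rge0 ?subr_ge0// pmulrn_lgt0.
Qed.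

Lemma enormD x y : enorm (x + y) <= enorm x + enorm y.
Proof.
rewrite -(@ler_pXn2r _ 2)// ?nnegrE ?addr_ge0 ?enorm_ge0// enorm_sqr.
under eq_bigr => i _ do rewrite mxE sqrrD.
rewrite !big_split/= sqrrD -!enorm_sqr lerD2r lerD2l -mulr2n.
by rewrite ler_pMn2r// cauchy_schwarz.
Qed.

Lemma enorm_dist_triangle x y z : enorm (x - z) <= enorm (x - y) + enorm (y - z).
Proof. by rewrite -[x - z](subrKA y) enormD. Qed.

Lemma norm_le_enorm x : `|x| <= enorm x.
Proof.
rewrite [`|x|]mx_normrE; apply: bigmax_le => [|[i j] _]; first exact: enorm_ge0.
by rewrite /= (ord1 j) abs_coord_le_enorm.
Qed.

Lemma enorm_le_sum x : enorm x <= \sum_(i < d) `|x i 0|.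
Proof.
have s0 : 0 <= \sum_(i < d) `|x i 0| by rewrite sumr_ge0.
rewrite -(@ler_pXn2r _ 2)// ?nnegrE ?enorm_ge0// enorm_sqr expr2 mulr_suml.
apply: ler_sum => i _; rewrite -real_normK ?num_real// expr2.
by rewrite ler_wpM2l// (bigD1 i)//= lerDl sumr_ge0.
Qed.

Lemma enorm_le_norm x : enorm x <= d%:R * `|x|.
Proof.
apply: le_trans (enorm_le_sum x) _.
rewrite -[d in d%:R]card_ord mulr_natl -sumr_const; apply: ler_sum => i _.
rewrite [`|x|]mx_normrE.
exact: (le_bigmax _ (fun ij : 'I_d * 'I_1 => `|x ij.1 ij.2|) (i, 0)).
Qed.

End EuclideanNorm.

(** * Horizontal components *)

Section HorizontalComponents.
Context {m : nat}.
Variable H : rel (word m).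
Hypothesis H_sym : symmetric H.
Hypothesis H_size : forall x y, H x y -> size x = size y.
Implicit Types (x y z u v w : word m) (T : set (word m)).

Definition hconn x y : Prop := exists2 p, path H x p & last x p = y.

Lemma hconn_refl x : hconn x x.
Proof. by exists [::]. Qed.

Lemma hconn_trans y x z : hconn x y -> hconn y z -> hconn x z.
Proof.
move=> [p xp <-] [q yq <-]; exists (p ++ q); last by rewrite last_cat.
by rewrite cat_path xp.
Qed.

Lemma hconn_edge x y : H x y -> hconn x y.
Proof. by move=> xy; exists [:: y] => //=; rewrite xy. Qed.

Lemma path_reverse (E : rel (word m)) (E_sym : symmetric E) x p : path E x p ->
  exists q, [/\ path E (last x p) q, last (last x p) q = x & size q = size p].
Proof.
elim: p x => [|a p IH] x /=; first by exists [::].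
case/andP => xa /IH [q [aq lq sq]]; exists (rcons q x).
by rewrite rcons_path aq lq E_sym xa last_rcons size_rcons sq.
Qed.

Lemma hconn_sym x y : hconn x y -> hconn y x.
Proof. by move=> [p /(path_reverse H_sym)[q [? ? _]] <-]; exists q. Qed.

Lemma hconn_size x y : hconn x y -> size x = size y.
Proof.
move=> [p + <-]; elim: p x => //= a p IH x /andP[xa /IH <-].
exact: H_size.
Qed.

Lemma hconn_mem x p w : path H x p -> w \in p -> hconn x w.
Proof.
move=> + wp; case/splitPr: wp => p1 p2; rewrite -cat_rcons cat_path => /andP[? _].
by exists (rcons p1 w); rewrite // last_rcons.
Qed.

Lemma hconn_hcomponent x : hcomponent H [set y | hconn x y].
Proof.
exists (size x); split=> [|T' [_ _ conT'] TT'].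
  split=> [|u /hconn_size//|u v xu xv]; first by exists x; exact: hconn_refl.
  have [p up pv] := hconn_trans (hconn_sym xu) xv.
  by exists p; split=> // w /(hconn_mem up); exact: hconn_trans.
apply/seteqP; split=> // y T'y.
by have [p [xp py _]] := conT' _ _ (TT' x (hconn_refl x)) T'y; exists p.
Qed.

(** Equivalent components together with their offspring are equipotent, so the
finitely many classes give a single bound for the cardinality of all
components. *)
Lemma simple_components_bounded (V : rel (word m)) : simple_tree V H ->
  exists N, forall T, hcomponent H T ->
    exists2 s : seq (word m), (size s <= N)%N & T `<=` [set` s].
Proof.
move=> /finite_seqP[cs csE].
have bounded c : exists B : nat, c \in cs -> forall T', c T' ->
    exists2 s : seq (word m), (size s <= B)%N & T' `<=` [set` s].
  have [ccs|_] := boolP (c \in cs); last by exists 0.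
  have : [set` cs] c by [].
  rewrite -csE => -[T [n [[_ Tn _] _]] <-{c ccs}].
  have /finite_seqP[s0 s0E] : finite_set (T `|` offspring T).
    pose f k : seq (word m) := [seq tval t | t : k.-tuple 'I_m].
    have fP (x : word m) : x \in f (size x).
      by apply/mapP; exists (in_tuple x); rewrite ?mem_enum.
    apply: (@sub_finite_set _ _ [set` f n ++ f n.+1]); last exact: finite_seq.
    move=> x /= [Tx|[[y i] [/= Ty _] <-]]; rewrite mem_cat.
      by rewrite -(Tn x Tx) fP.
    by rewrite -(Tn y Ty) -(size_rcons y i) fP orbT.
  exists (size s0) => _ T' [_ [g [[_ _ gsurj] _]]].
  exists (map g s0) => [|x T'x]; first by rewrite size_map.
  have [y Ty <-] := gsurj x (or_introl T'x).
  by apply/mapP; exists y => //; move: Ty; rewrite s0E.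
have [B BP] := choice bounded.
exists (\max_(c <- cs) B c) => T compT.
have TT : hequiv_class V H T T.
  split=> //; exists id; split=> //.
  by split=> [x //|x y _ _ //|x Tx]; exists x.
have Tcs : hequiv_class V H T \in cs.
  have : [set hequiv_class V H T | T in hcomponent H] (hequiv_class V H T).
    by exists T.
  by rewrite csE.
have [s ss Ts] := BP _ Tcs T TT; exists s => //.
by apply: leq_trans ss _; exact: leq_bigmax_seq.
Qed.

(** A horizontal path can be shortened to one without repetitions, whose length
is then at most the cardinality of the component. *)
Lemma simple_hpath_bounded (V : rel (word m)) : simple_tree V H ->
  exists N, forall x y, hconn x y ->
    exists p, [/\ path H x p, last x p = y & (size p <= N)%N].
Proof.
move=> /simple_components_bounded[N NP]; exists N => x _ [p xp <-].
have [s ss Ts] := NP _ (hconn_hcomponent x).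
case/shortenP: xp => p' xp' /= /andP[_ up'] _; exists p'; split=> //.
apply: leq_trans ss; apply: uniq_leq_size => // w wp'.
exact: Ts (hconn_mem xp' wp').
Qed.

End HorizontalComponents.

(** * Gromov products in an augmented tree *)

Section AugmentedTree.
Context {R : realType} {m : nat}.
Variable H : rel (word m).
Hypothesis H_sym : symmetric H.
Hypothesis H_size : forall x y, H x y -> size x = size y.
Hypothesis H_take : forall k x y, H x y ->
  take k x = take k y \/ H (take k x) (take k y).
Implicit Types (x y z u v w : word m) (k n : nat).

Let E : rel (word m) := fun x y => vedge x y || H x y.

Lemma vedge_sym : symmetric (@vedge m).
Proof. by move=> x y; rewrite /vedge orbC. Qed.

Let E_sym : symmetric E.
Proof. by move=> x y; rewrite /E vedge_sym H_sym. Qed.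

Lemma edge_size x y : E x y -> (size x <= (size y).+1)%N.
Proof.
case/orP => [/orP[]/existsP[i /eqP->]|/H_size->//]; rewrite size_rcons//.
by rewrite ltnW// ltnW.
Qed.

Lemma path_size x p : path E x p ->
  (size x <= size (last x p) + size p)%N /\
  (size (last x p) <= size x + size p)%N.
Proof.
elim: p x => [|a p IH] x /=; first by rewrite addn0.
case/andP => xa /IH[]; have := edge_size xa; rewrite E_sym in xa.
by have := edge_size xa; lia.
Qed.

Lemma edge_hconn_take k x y : E x y -> (k <= size x)%N -> (k <= size y)%N ->
  hconn H (take k x) (take k y).
Proof.
case/orP => [/orP[]/existsP[i /eqP->]|/(H_take k)[->|/hconn_edge//]] kx ky.
- by rewrite -cats1 takel_cat//; exact: hconn_refl.
- by rewrite -cats1 takel_cat//; exact: hconn_refl.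
- exact: hconn_refl.
Qed.

(** Truncation at level [k] sends vertical edges above level [k] to points and
horizontal edges to points or edges. *)
Lemma path_hconn_take k x p : path E x p ->
  all (fun z => k <= size z)%N (x :: p) ->
  hconn H (take k x) (take k (last x p)).
Proof.
elim: p x => [|a p IH] x /=; first by move=> _ _; exact: hconn_refl.
case/andP=> xa ap /and3P[kx ka kp].
by apply: hconn_trans (edge_hconn_take xa kx ka) _; apply: IH; rewrite //= ka.
Qed.

Lemma vertical_path u w :
  exists p, [/\ path E u p, last u p = u ++ w & size p = size w].
Proof.
elim: w u => [|i w IH] u; first by exists [::]; rewrite cats0.
have [p [pp lp sp]] := IH (rcons u i); exists (rcons u i :: p).
rewrite /= lp cat_rcons sp pp andbT; split=> //.
by apply/orP; left; apply/orP; left; apply/existsP; exists i.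
Qed.

(** Ascend from [x] to level [k], follow [p], then descend to [y]. *)
Lemma path_through k x y p : (k <= size x)%N -> (k <= size y)%N ->
  path H (take k x) p -> last (take k x) p = take k y ->
  exists q, [/\ path E x q, last x q = y &
    size q = (size x - k + size p + (size y - k))%N].
Proof.
move=> kx ky Hp lp.
have [p1 [+ + s1]] := vertical_path (take k x) (drop k x).
rewrite cat_take_drop => P1 L1.
have [p2 [P2 + s2]] := vertical_path (take k y) (drop k y).
rewrite cat_take_drop => L2.
have [q1 []] := path_reverse E_sym P1; rewrite L1 => Q1 M1 t1.
exists (q1 ++ p ++ p2).
rewrite !cat_path !last_cat Q1 M1 lp P2 L2 !size_cat t1 s1 s2 !size_drop addnA.
by rewrite andbT; split=> //; apply: sub_path Hp => a b ab; rewrite /E ab orbT.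
Qed.

Lemma connected_through_root x y : exists q, [/\ path E x q, last x q = y &
  (size q = size x + size y)%N].
Proof.
have l0 : last (take 0 x) [::] = take 0 y by rewrite !take0.
have h0 : path H (take 0 x) [::] by [].
have [q [xq qy sq]] := path_through (leq0n _) (leq0n _) h0 l0.
by exists q; rewrite sq addn0 !subn0.
Qed.

Lemma gdist_le_path x p : path E x p -> gdist E x (last x p) <= (size p)%:R :> R.
Proof.
move=> xp; apply: ge_inf; first by exists 0 => _ [q _ <-].
by exists p.
Qed.

Lemma gdist_ge (L : R) x y :
  (forall p, path E x p -> last x p = y -> L <= (size p)%:R) -> L <= gdist E x y.
Proof.
move=> Lp; apply: lb_le_inf => [|_ [p [xp py] <-]]; last exact: Lp.
by have [q [xq qy _]] := connected_through_root x y; exists (size q)%:R, q.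
Qed.

Lemma gdist_sym x y : gdist E x y = gdist E y x :> R.
Proof.
wlog suff le_sym : x y / gdist E x y <= gdist E y x :> R.
  by apply/eqP; rewrite eq_le !le_sym.
apply: gdist_ge => p yp <-; have [q [xq qy <-]] := path_reverse E_sym yp.
by have := gdist_le_path xq; rewrite qy.
Qed.

Lemma height_size x : height E x = (size x)%:R :> R.
Proof.
apply/eqP; rewrite eq_le; apply/andP; split.
  have [q [qq qx sq]] := connected_through_root [::] x.
  by have := gdist_le_path qq; rewrite qx sq.
by apply: gdist_ge => p /path_size[_ +] px; rewrite px /= ler_nat.
Qed.

Lemma gromov_sym x y : gromov E x y = gromov E y x :> R.
Proof. by rewrite /gromov gdist_sym (addrC (height E x)). Qed.

Lemma gromov_ge0 x y : 0 <= gromov E x y :> R.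
Proof.
rewrite divr_ge0// subr_ge0 !height_size -natrD.
have [q [qq qy sq]] := connected_through_root x y.
by have := gdist_le_path qq; rewrite qy sq.
Qed.

Lemma gromov_le_size x y : gromov E x y <= (size x)%:R :> R.
Proof.
rewrite ler_pdivrMr// !height_size lerBlDr -lerBlDl.
apply: gdist_ge => p /path_size[_ +] px; rewrite px -(ler_nat R) !natrD.
by lra.
Qed.

(** A path between [x] and [y] either stays above level [k], and projects to a
horizontal path at level [k.+1], or descends to a vertex of level at most
[k]. *)
Lemma gromov_le_level k x y : ~ hconn H (take k.+1 x) (take k.+1 y) ->
  gromov E x y <= k%:R :> R.
Proof.
move=> nxy; rewrite ler_pdivrMr// !height_size lerBlDr -lerBlDl.
apply: gdist_ge => p xp px.
suff : (size x + size y <= k * 2 + size p)%N.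
  by rewrite -(ler_nat R) !natrD natrM; lra.
have [/(path_hconn_take xp)|] := boolP (all (fun z => k < size z)%N (x :: p)).
  by rewrite px.
case/allPn => z zp; rewrite -leqNgt => zk.
case/splitPl: zp xp px => p1 p2 zE; rewrite cat_path last_cat zE size_cat.
by move=> /andP[/path_size[+ _] /path_size[_ +]] zy; rewrite zE zy; lia.
Qed.

Lemma gromov_ge_level k x y p : (k <= size x)%N -> (k <= size y)%N ->
  path H (take k x) p -> last (take k x) p = take k y ->
  k%:R - (size p)%:R / 2 <= gromov E x y :> R.
Proof.
move=> kx ky Hp lp; have [q [xq qy sq]] := path_through kx ky Hp lp.
rewrite ler_pdivlMr// !height_size lerBrDr; have := gdist_le_path xq.
rewrite qy sq !natrD !natrB//; lra.
Qed.

(** The level [k] is the last one at which [x] and [y] lie over the same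
horizontal component.  When components have bounded diameter, [k] is, by this
upper bound and by [gromov_ge_level], the Gromov product up to a bounded
error. *)
Lemma confluence_level x y : exists k, [/\ (k <= size x)%N, (k <= size y)%N,
  hconn H (take k x) (take k y), gromov E x y <= k%:R :> R &
  (k < size x)%N -> (k < size y)%N -> ~ hconn H (take k.+1 x) (take k.+1 y)].
Proof.
pose P k := `[< [/\ (k <= size x)%N, (k <= size y)%N &
  hconn H (take k x) (take k y)] >].
have P0 : exists k, P k.
  by exists 0%N; apply/asboolP; split=> //; rewrite !take0; exact: hconn_refl.
have Pb k : P k -> (k <= size x)%N by case/asboolP.
case: (ex_maxnP P0 Pb) => k /asboolP[kx ky xy] kmax.
have nxy : (k < size x)%N -> (k < size y)%N ->
    ~ hconn H (take k.+1 x) (take k.+1 y).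
  move=> kx' ky' xy'; suff /kmax : P k.+1 by rewrite ltnn.
  by apply/asboolP.
exists k; split=> //; have [kx'|kx'] := ltnP k (size x); last first.
  by apply: le_trans (gromov_le_size x y) _; rewrite ler_nat.
have [ky'|ky'] := ltnP k (size y); last first.
  by rewrite gromov_sym; apply: le_trans (gromov_le_size y x) _; rewrite ler_nat.
exact/gromov_le_level/nxy.
Qed.

Lemma rho_sym (a : R) x y : rho E a x y = rho E a y x.
Proof. by rewrite /rho eq_sym gromov_sym. Qed.

Lemma rho_le1 (a : R) x y : 0 < a -> rho E a x y <= 1.
Proof.
move=> a0; rewrite /rho; case: eqP => // _.
by rewrite -expR0 ler_expR mulNr oppr_le0 mulr_ge0 ?gromov_ge0// ltW.
Qed.

(** A vertex is at positive distance from all other vertices, because a Gromov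
product is at most the height of either argument. *)
Lemma rho_ge_size (a : R) x y : 0 < a -> x != y ->
  expR (- a * (size x)%:R) <= rho E a x y.
Proof.
move=> a0 /negPf xy; rewrite /rho xy ler_expR !mulNr lerN2.
by rewrite ler_wpM2l ?gromov_le_size// ltW.
Qed.

(** The exponential of the hyperbolicity inequality; the factor is at least [1],
which covers the coincidences among the three vertices, where [rho] vanishes. *)
Lemma rho_quasi_ultrametric (a delta : R) x y z : 0 < a -> hyperbolic E delta ->
  rho E a x y <= expR (a * delta) * Num.max (rho E a x z) (rho E a z y).
Proof.
move=> a0 [d0 hyp]; have A1 : 1 <= expR (a * delta).
  by rewrite -expR0 ler_expR mulr_ge0// ltW.
have [<-|xy] := eqVneq x y.
  rewrite {1}/rho eqxx mulr_ge0 ?expR_ge0// le_max; apply/orP; left.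
  by rewrite /rho; case: ifP => // _; exact: expR_ge0.
have [<-|xz] := eqVneq x z.
  apply: (@le_trans _ _ (Num.max (rho E a x x) (rho E a x y))).
    by rewrite le_max lexx orbT.
  by rewrite ler_peMl// le_max /rho eqxx lexx.
have [->|zy] := eqVneq z y.
  apply: (@le_trans _ _ (Num.max (rho E a x y) (rho E a y y))).
    by rewrite le_max lexx.
  by rewrite ler_peMl// le_max /rho eqxx lexx orbT.
have := hyp x y z; rewrite /rho (negPf xy) (negPf xz) (negPf zy).
rewrite maxr_pMr ?expR_ge0// -!expRD le_max !ler_expR => hyp_xyz.
have le_expo t : t - delta <= gromov E x y ->
    - a * gromov E x y <= a * delta + - a * t.
  by move=> /(ler_wpM2l (ltW a0)); lra.
by move: hyp_xyz; case: (leP (gromov E x z)) => _ /le_expo ->; rewrite ?orbT.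
Qed.

End AugmentedTree.

(** * Cells of a self-similar set *)

Section SelfSimilarCells.
Context {R : realType} {d m : nat}.
Variables (r : R) (Q : 'I_m -> 'M[R]_d) (b : 'I_m -> 'cV[R]_d).
Variable S : 'I_m -> 'cV[R]_d -> 'cV[R]_d.
Hypotheses (r_gt0 : 0 < r) (r_lt1 : r < 1).
Hypothesis Q_orthogonal : forall i, (Q i)^T *m Q i = 1%:M.
Hypothesis S_similitude : forall i x, S i x = r *: (Q i *m x) + b i.
Implicit Types (u v w : word m) (x y z : 'cV[R]_d) (A J K : set 'cV[R]_d).

Lemma enorm_Sword u x y :
  enorm (Sword S u x - Sword S u y) = r ^+ size u * enorm (x - y).
Proof.
elim: u => [|i u IH] /=; first by rewrite mul1r.
rewrite !S_similitude opprD addrACA subrr addr0 -scalerBr -mulmxBr enormZ ?ltW//.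
by rewrite enorm_orthogonal// IH exprS mulrA.
Qed.

Lemma Sword_cat u v x : Sword S (u ++ v) x = Sword S u (Sword S v x).
Proof. by rewrite /Sword foldr_cat. Qed.

Section Invariant.
Variable A : set 'cV[R]_d.
Hypothesis A_invariant : forall i, S i @` A `<=` A.

Lemma Sword_invariant u x : A x -> A (Sword S u x).
Proof.
move=> Ax; elim: u => //= i u IH.
by apply: A_invariant; exists (Sword S u x).
Qed.

Lemma cell_take k u : cell S A u `<=` cell S A (take k u).
Proof.
move=> _ [x Ax <-]; rewrite -{2}(cat_take_drop k u) Sword_cat.
by exists (Sword S (drop k u) x) => //; exact: Sword_invariant.
Qed.

Lemma cell_Sword_take k u x : A x -> cell S A (take k u) (Sword S u x).
Proof. by move=> Ax; apply: cell_take; exists x. Qed.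

Lemma hedge_sym : symmetric (hedge S A).
Proof. by move=> u v; rewrite /hedge eq_sym (eq_sym (size u)) setIC. Qed.

Lemma hedge_size u v : hedge S A u v -> size u = size v.
Proof. by case/and3P=> _ /eqP. Qed.

(** Cells decrease along words, so truncations of intersecting cells
intersect. *)
Lemma hedge_take k u v : hedge S A u v ->
  take k u = take k v \/ hedge S A (take k u) (take k v).
Proof.
case/and3P=> _ /eqP uv /asboolP[x [ux vx]].
have [->|neq] := eqVneq (take k u) (take k v); [by left|right].
rewrite /hedge neq !size_take uv eqxx/=; apply/asboolP; exists x.
by split; exact: cell_take.
Qed.

(** Consecutive cells of a horizontal path meet and have the same diameter, so
the distance across the path is at most the number of cells times it. *)
Lemma hedge_path_diameter M u p x y :
  (forall x y, A x -> A y -> enorm (x - y) <= M) ->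
  path (hedge S A) u p -> cell S A u x -> cell S A (last u p) y ->
  enorm (x - y) <= (size p).+1%:R * M * r ^+ size u.
Proof.
move=> AM; have cellM w z1 z2 : cell S A w z1 -> cell S A w z2 ->
    enorm (z1 - z2) <= M * r ^+ size w.
  move=> [s As <-] [t At <-]; rewrite enorm_Sword mulrC ler_wpM2r//.
  - by rewrite exprn_ge0// ltW.
  - exact: AM.
elim: p u x => [|v p IH] u x /=; first by rewrite mul1r => _; exact: cellM.
case/andP => /and3P[_ /eqP uv /asboolP[z [uz vz]]] vp ux vy.
apply: le_trans (enorm_dist_triangle x z y) _.
rewrite -[X in X%:R]add1n natrD !mulrDl mul1r lerD ?cellM//.
by rewrite uv IH.
Qed.

End Invariant.

Lemma bounded_enorm A : bounded_set A ->
  exists2 M, 0 < M & forall x y, A x -> A y -> enorm (x - y) <= M.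
Proof.
case/pinfty_ex_gt0 => M M0 AM; exists (d%:R * (M + M) + 1).
  by rewrite ltr_wpDl// mulr_ge0// addr_ge0// ltW.
move=> x y Ax Ay; apply: le_trans (enorm_le_norm _) _.
rewrite ler_wpDr// ler_wpM2l//; apply: le_trans (ler_normB _ _) _.
by rewrite lerD// AM.
Qed.

Lemma expr_lt_eventually (e : R) : 0 < e ->
  exists N, forall n, (N <= n)%N -> r ^+ n < e.
Proof.
move=> e0; have := @cvg_expr R r; rewrite ger0_norm ?ltW// => /(_ r_lt1).
move=> /cvgrPdist_lt/(_ _ e0)[N _ NP]; exists N => n /NP.
by rewrite sub0r normrN ger0_norm// exprn_ge0// ltW.
Qed.

Section Attractor.
Variable K : set 'cV[R]_d.
Hypothesis K_self_similar : self_similar_set S K.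

Lemma self_similar_invariant i : S i @` K `<=` K.
Proof. by case: K_self_similar => _ _ KE x ix; rewrite KE; exists i. Qed.

Lemma self_similar_cells n x : K x -> exists2 u, size u = n & cell S K u x.
Proof.
elim: n x => [|n IH] x Kx; first by exists [::] => //; exists x.
case: K_self_similar => _ _ KE; move: Kx; rewrite {1}KE => -[i _ [y Ky <-]].
have [u un [z Kz <-]] := IH y Ky.
by exists (i :: u); [rewrite /= un|exists z].
Qed.

(** Each point of [K] is within distance [r ^+ n] times a constant of some cell
of [J] of level [n], hence is a limit of points of [J]. *)
Lemma self_similar_sub J : bounded_closed_invariant S J -> K `<=` J.
Proof.
case=> -[j Jj] Jb Jc Jinv x Kx; case: K_self_similar => _ Kc _.
have [M M0 KM] : exists2 M, 0 < M & forall z, K z -> enorm (z - j) < M.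
  have [M M0 KM] := bounded_enorm (compact_bounded Kc).
  exists (M + enorm (x - j) + 1) => [|z Kz].
    by rewrite ltr_wpDl// addr_ge0 ?enorm_ge0// ltW.
  rewrite ltr_pwDr//; apply: le_trans (enorm_dist_triangle z x j) _.
  by rewrite lerD2r KM.
apply: Jc => B /nbhs_normP[e /= e0 eB].
have [n /(_ n (leqnn n)) ne] := expr_lt_eventually (divr_gt0 e0 M0).
have [u un [z Kz ux]] := self_similar_cells n Kx.
exists (Sword S u j); split; first exact: Sword_invariant.
apply: eB => /=.
apply: le_lt_trans (norm_le_enorm _) _.
rewrite -ux enorm_Sword un.
by rewrite -(divfK (lt0r_neq0 M0) e) ltr_pM ?exprn_ge0 ?enorm_ge0 ?ltW// KM.
Qed.

End Attractor.
End SelfSimilarCells.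

(** * Comparison of the two metrics on vertices *)

Section Comparison.
Context {R : realType} {d m : nat}.
Variables (r : R) (Q : 'I_m -> 'M[R]_d) (b : 'I_m -> 'cV[R]_d).
Variable S : 'I_m -> 'cV[R]_d -> 'cV[R]_d.
Hypotheses (r_gt0 : 0 < r) (r_lt1 : r < 1).
Hypothesis Q_orthogonal : forall i, (Q i)^T *m Q i = 1%:M.
Hypothesis S_similitude : forall i x, S i x = r *: (Q i *m x) + b i.
Variables K J : set 'cV[R]_d.
Hypothesis K_self_similar : self_similar_set S K.
Hypothesis K_condH : condH S r K.
Hypothesis J_invariant : bounded_closed_invariant S J.
Hypothesis X_simple : simple_tree (@vedge m) (hedge S J).

Let J_inv i : S i @` J `<=` J. Proof. by case: J_invariant. Qed.

(** The exponent [- ln r / a] converts the visual parameter [exp (- a)] into the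
ratio [r]. *)
Lemma rho_powR (a : R) x y : 0 < a -> x != y ->
  rho (edge S J) a x y `^ (- ln r / a) = r `^ gromov (edge S J) x y.
Proof.
move=> a_gt0 /negPf xy; rewrite /rho xy /powR gt_eqF ?expR_gt0// gt_eqF//.
rewrite expRK; congr expR; field.
by rewrite gt_eqF.
Qed.

(** Let [k] be the confluence level of distinct [x] and [y], so that [rho x y] to
the power [- ln r / a] is comparable with [r ^+ k].  At level [k] both vertices lie over
one component, which has boundedly many cells of diameter comparable with
[r ^+ k]: this bounds the distance of the images from above.  At level [k.+1],
if both words reach it, the cells of [J] over which they lie are disjoint, hence
so are those of [K], and condition (H) bounds the distance from below by a
multiple of [r ^+ k]; otherwise [r ^+ k] is one of [r ^+ size x] and
[r ^+ size y]. *)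
Lemma rho_comparison (a : R) p : 0 < a -> K p -> exists2 C, 0 < C &
  forall x y,
    enorm (Sword S x p - Sword S y p)
      <= C * rho (edge S J) a x y `^ (- ln r / a) /\
    rho (edge S J) a x y `^ (- ln r / a)
      <= C * (enorm (Sword S x p - Sword S y p) + r ^+ size x + r ^+ size y).
Proof.
move=> a_gt0 Kp.
have H_sym := hedge_sym S J; have H_size := @hedge_size _ _ _ S J.
have H_take := hedge_take J_inv.
have [N NP] := simple_hpath_bounded H_sym H_size X_simple.
have [M M0 JM] : exists2 M, 0 < M & forall x y, J x -> J y -> enorm (x - y) <= M.
  by case: J_invariant => _ /bounded_enorm.
have KJ := self_similar_sub r_gt0 r_lt1 Q_orthogonal S_similitude
  K_self_similar J_invariant.
have [c c0 cP] := K_condH.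
have powk k : r ^+ k = r `^ k%:R by rewrite powR_mulrn// ltW.
have r01 : 0 < r <= 1 by rewrite r_gt0 ltW.
have rn0 n : 0 < r ^+ n by rewrite exprn_gt0.
(* [B] compensates for the gap [N / 2] between the confluence level and the
   Gromov product; a horizontal path of length at most [N] meets at most [N.+1]
   cells. *)
pose B := r `^ (- (N%:R / 2)); have B0 : 0 < B by exact: powR_gt0.
pose C := N.+1%:R * M + B * (1 + (c * r)^-1).
have C1 : 0 < N.+1%:R * M by rewrite mulr_gt0.
have cr0 : 0 < (c * r)^-1 by rewrite invr_gt0 mulr_gt0.
have C2 : 0 < B * (1 + (c * r)^-1) by rewrite mulr_gt0// addr_gt0.
exists C => [|x y]; first by rewrite addr_gt0.
have [<-|xy] := eqVneq x y.
  rewrite subrr enorm0 /rho eqxx powR0; last first.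
    by rewrite gt_eqF// divr_gt0// oppr_gt0 ln_lt0// r_gt0.
  by rewrite mulr0 mulr_ge0// ?addr_ge0// ltW// addr_gt0.
rewrite rho_powR//; set g := gromov _ x y; set D := enorm _.
have D0 : 0 <= D by exact: enorm_ge0.
have [k [kx ky kxy gk gmax]] :=
  @confluence_level R _ _ H_sym H_size H_take x y.
have [q [Hq lq qN]] := NP _ _ kxy.
have sx : size (take k x) = k by rewrite size_takel.
split.
  have : D <= (size q).+1%:R * M * r ^+ size (take k x).
    apply: (hedge_path_diameter r_gt0 Q_orthogonal S_similitude JM Hq).
      by apply: (cell_Sword_take J_inv); exact: KJ.
    by rewrite lq; apply: (cell_Sword_take J_inv); exact: KJ.
  rewrite sx => /le_trans; apply.
  have rkg : r ^+ k <= r `^ g by rewrite powk ger_powR.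
  apply: ler_pM => //; [by rewrite mulr_ge0// ltW|by rewrite ltW|].
  have C1_le : N.+1%:R * M <= C by rewrite lerDl ltW.
  by apply: le_trans C1_le; rewrite ler_wpM2r ?ler_nat// ltW.
have kg : k%:R - N%:R / 2 <= g.
  have kg : k%:R - (size q)%:R / 2 <= g.
    exact: (gromov_ge_level H_sym H_size kx ky Hq lq).
  by apply: le_trans kg; rewrite lerD2l lerN2 ler_wpM2r// ler_nat.
have gB : r `^ g <= B * r ^+ k.
  rewrite powk mulrC -powRD; last by rewrite (gt_eqF r_gt0) implybT.
  by rewrite ger_powR.
apply: le_trans gB _; rewrite -/D.
have rk : r ^+ k <= (1 + (c * r)^-1) * (D + r ^+ size x + r ^+ size y).
  have crD : 0 <= (c * r)^-1 * (D + r ^+ size x + r ^+ size y).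
    by rewrite mulr_ge0 ?addr_ge0// ltW.
  rewrite mulrDl mul1r.
  have [kx'|kx'] := ltnP k (size x); last first.
    have -> : k = size x by apply/eqP; rewrite eqn_leq kx kx'.
    by rewrite ler_wpDr// -addrA addrCA lerDl addr_ge0// ltW.
  have [ky'|ky'] := ltnP k (size y); last first.
    have -> : k = size y by apply/eqP; rewrite eqn_leq ky ky'.
    by rewrite ler_wpDr// lerDr addr_ge0// ltW.
  have cD : c * r ^+ k.+1 <= D.
    apply: le_trans (cP k.+1 (take k.+1 x) (take k.+1 y) _ _ _ _) _ => //.
    - by rewrite size_takel.
    - by rewrite size_takel.
    - apply/eqP/negPn/negP => /set0P[z [[s Ks sz] [t Kt tz]]].
      apply: (gmax kx' ky').
      have [->|neq] := eqVneq (take k.+1 x) (take k.+1 y).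
        exact: hconn_refl.
      apply: hconn_edge; rewrite /hedge neq !size_takel// eqxx/=.
      apply/asboolP; exists z.
      by split; [exists s => //; exact: KJ|exists t => //; exact: KJ].
    - apply: ge_inf; first by exists 0 => _ [w _ <-]; exact: enorm_ge0.
      exists (Sword S x p, Sword S y p) => //.
      by split; apply: (cell_Sword_take (self_similar_invariant K_self_similar)).
  have -> : r ^+ k = (c * r)^-1 * (c * r ^+ k.+1).
    by rewrite exprS mulrA mulKf// gt_eqF// mulr_gt0.
  rewrite ler_wpDl ?addr_ge0 ?(ltW (rn0 _))// ler_wpM2l ?(ltW cr0)//.
  by apply: le_trans cD _; rewrite -addrA lerDl addr_ge0// ltW.
rewrite /C [in leRHS]mulrDl ler_wpDl//.
  by rewrite mulr_ge0 ?addr_ge0// ltW.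
by rewrite -mulrA ler_wpM2l// ltW.
Qed.

End Comparison.

(** * Extension of a map of vertices to the boundary *)

Section BoundaryMap.
Context {R : realType} {d m : nat}.
Variables (E : rel (word m)) (a al r A C : R).
Variables (P : word m -> 'cV[R]_d) (K : set 'cV[R]_d).
Hypotheses (al_gt0 : 0 < al) (r_gt0 : 0 < r) (r_lt1 : r < 1).
Hypotheses (A_gt0 : 0 < A) (C_gt0 : 0 < C).
Implicit Types (x y z : nat -> word m) (u v : word m).
Implicit Types xi eta : set (nat -> word m).

Local Notation rho := (rho E a).
Local Notation boundary := (boundary E a).

Hypothesis rho_symm : forall u v, rho u v = rho v u.
Hypothesis rho_le_1 : forall u v, rho u v <= 1.
Hypothesis rho_isolated : forall u v, u != v -> expR (- a * (size u)%:R) <= rho u v.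
Hypothesis rho_quasi : forall u v w, rho u v <= A * Num.max (rho u w) (rho w v).
Hypothesis a_gt0 : 0 < a.
Hypothesis dist_le_rho : forall u v, enorm (P u - P v) <= C * rho u v `^ al.
Hypothesis rho_le_dist : forall u v,
  rho u v `^ al <= C * (enorm (P u - P v) + r ^+ size u + r ^+ size v).
Hypothesis K_compact : compact K.
Hypothesis P_in_K : forall u, K (P u).

Definition escapes x : Prop := forall n, \forall i \near \oo, (n <= size (x i))%N.

Let al_neq0 : al != 0. Proof. by rewrite gt_eqF. Qed.

Lemma rho_ge0 u v : 0 <= rho u v.
Proof. by rewrite /Defs.rho; case: ifP => // _; exact: expR_ge0. Qed.

Lemma ge0_cvg0P (f : nat -> R) : (forall n, 0 <= f n) ->
  f @ \oo --> (0 : R) <-> forall e, 0 < e -> \forall n \near \oo, f n < e.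
Proof.
move=> f0; split=> [/cvgr0Pnorm_lt f_cvg e /f_cvg|fe].
  by apply: filterS => n; rewrite ger0_norm.
by apply/cvgr0Pnorm_lt => e /fe; apply: filterS => n; rewrite ger0_norm.
Qed.

Lemma powR_lt (s t : R) : 0 <= s -> 0 <= t -> s < t `^ al^-1 -> s `^ al < t.
Proof.
move=> s0 t0 st; rewrite -[ltRHS](powRr1 t0) -(mulVf al_neq0) powRrM.
by apply: gt0_ltr_powR; rewrite ?nnegrE ?powR_ge0.
Qed.

Lemma lt_powR (s t : R) : 0 <= s -> 0 <= t -> s `^ al < t -> s < t `^ al^-1.
Proof.
move=> s0 t0 st; rewrite -[ltLHS](powRr1 s0) -(mulfV al_neq0) powRrM.
by apply: gt0_ltr_powR; rewrite ?nnegrE ?powR_ge0// invr_gt0.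
Qed.

Lemma escapes_expr_cvg0 x : escapes x -> (fun n => r ^+ size (x n)) @ \oo --> 0.
Proof.
move=> xoo; apply/ge0_cvg0P => [n|e e0]; first by rewrite exprn_ge0// ltW.
have [N rN] := expr_lt_eventually r_gt0 r_lt1 e0.
by apply: filterS (xoo N) => n /rN.
Qed.

(** If the heights return below [n] infinitely often, then the isolation of the
vertices of height less than [n] makes the sequence stationary. *)
Lemma rho_cauchy_dichotomy x : rho_cauchy E a x ->
  escapes x \/ exists u, \forall i \near \oo, x i = u.
Proof.
move=> xc; have [|/existsNP[n nx]] := pselect (escapes x); [by left|right].
have [N NP] := xc _ (expR_gt0 (- a * n%:R)).
have [i Ni xi] : exists2 i, (N <= i)%N & (size (x i) < n)%N.
  apply: contrapT => nex; apply: nx; exists N => // i Ni.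
  by rewrite leqNgt; apply/negP => xi; apply: nex; exists i.
exists (x i); exists N => // j Nj; apply/eqP; rewrite eq_sym; apply: contraT => xij.
have := le_lt_trans (rho_isolated xij) (NP i j Ni Nj).
by rewrite ltr_expR !mulNr ltrN2 (ltr_pM2l a_gt0) ltr_nat ltnNge ltnW.
Qed.

Lemma rho_cvg0_trans x y z :
  (fun n => rho (x n) (y n)) @ \oo --> (0 : R) ->
  (fun n => rho (y n) (z n)) @ \oo --> (0 : R) ->
  (fun n => rho (x n) (z n)) @ \oo --> (0 : R).
Proof.
have r0 (f g : nat -> word m) n : 0 <= rho (f n) (g n) by exact: rho_ge0.
move=> /(ge0_cvg0P (r0 x y)) xy /(ge0_cvg0P (r0 y z)) yz.
apply/(ge0_cvg0P (r0 x z)) => e e0.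
have eA : 0 < e / A by rewrite divr_gt0.
move: (xy _ eA) (yz _ eA); apply: filterS2 => n xyn yzn.
apply: le_lt_trans (rho_quasi _ _ (y n)) _.
by rewrite mulrC -ltr_pdivlMr// gt_max xyn.
Qed.

Lemma rho_cvg0_refl x : (fun n => rho (x n) (x n)) @ \oo --> (0 : R).
Proof.
rewrite (_ : (fun n => _) = cst 0); first exact: cvg_cst.
by apply/funext => n; rewrite /Defs.rho eqxx.
Qed.

Lemma rho_cvg0_sym x y : (fun n => rho (x n) (y n)) @ \oo --> (0 : R) ->
  (fun n => rho (y n) (x n)) @ \oo --> (0 : R).
Proof. by under eq_fun do rewrite rho_symm. Qed.

Lemma cauchy_class_eq x y : (fun n => rho (x n) (y n)) @ \oo --> (0 : R) ->
  cauchy_class E a x = cauchy_class E a y.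
Proof.
move=> xy; apply/seteqP; split=> z [zc xz]; split=> //.
  exact: rho_cvg0_trans (rho_cvg0_sym xy) xz.
exact: rho_cvg0_trans xy xz.
Qed.

(** Vertices are isolated for [rho]: the completion adds exactly the classes of
the Cauchy sequences that leave every finite level. *)
Lemma boundary_representative xi y : boundary xi -> xi y ->
  [/\ rho_cauchy E a y, escapes y & xi = cauchy_class E a y].
Proof.
case=> -[x xc <-] nvertex [yc xy]; rewrite (cauchy_class_eq xy).
split=> //; have [//|[u yu]] := rho_cauchy_dichotomy yc.
case: nvertex; exists u => //; apply: cauchy_class_eq.
apply/ge0_cvg0P => [n|e e0]; first exact: rho_ge0.
have [N _ xye] := (ge0_cvg0P (fun n => rho_ge0 (x n) (y n))).1 xy e e0.
near=> n; rewrite rho_symm (_ : u = y n); first by near: n; exists N.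
by apply/esym; near: n.
Unshelve. all: by end_near. Qed.

Lemma boundary_nonempty xi : boundary xi -> exists y, xi y.
Proof. by case=> -[x xc <-] _; exists x; split=> //; exact: rho_cvg0_refl. Qed.

Lemma escapes_boundary x : rho_cauchy E a x -> escapes x ->
  boundary (cauchy_class E a x).
Proof.
move=> xc xoo; split; first by exists x.
case=> u _ ux; have [_ uxc] : cauchy_class E a (fun=> u) x.
  by rewrite ux; split=> //; exact: rho_cvg0_refl.
have [N _ NP] := (ge0_cvg0P (fun n => rho_ge0 u (x n))).1 uxc _
  (expR_gt0 (- a * (size u)%:R)).
have [M _ MP] := xoo (size u).+1.
have := NP _ (leq_maxl N M); rewrite /= ltNge rho_isolated//.
apply/eqP => ueq; have := MP _ (leq_maxr N M).
by rewrite /= -ueq ltnn.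
Qed.

Lemma rho_cvg0_dist_cvg0 x y : (fun n => rho (x n) (y n)) @ \oo --> (0 : R) ->
  (fun n => enorm (P (x n) - P (y n))) @ \oo --> (0 : R).
Proof.
move=> /ge0_cvg0P xy; apply/ge0_cvg0P => [n|e e0]; first exact: enorm_ge0.
have eC : 0 < e / C by rewrite divr_gt0.
have := xy (fun n => rho_ge0 _ _) _ (powR_gt0 al^-1 eC).
apply: filterS => n /(powR_lt (rho_ge0 _ _) (ltW eC)) xye.
by apply: le_lt_trans (dist_le_rho _ _) _; rewrite mulrC -ltr_pdivlMr.
Qed.

Lemma enorm_cvg0_unique (f g : nat -> 'cV[R]_d) (p q : 'cV[R]_d) :
  (fun n => enorm (f n - p)) @ \oo --> (0 : R) ->
  (fun n => enorm (g n - q)) @ \oo --> (0 : R) ->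
  (fun n => enorm (f n - g n)) @ \oo --> enorm (p - q).
Proof.
move=> fp gq; apply/cvgrPdist_le => e e0.
have fg0 : (fun n => enorm (f n - p) + enorm (g n - q)) @ \oo --> (0 : R).
  by have := cvgD fp gq; rewrite addr0; apply.
near=> n; apply: (@le_trans _ _ (enorm (f n - p) + enorm (g n - q))); last first.
  by apply: ltW; near: n; exact: cvgr_lt fg0 _ e0.
have := enorm_dist_triangle p (f n) q; have := enorm_dist_triangle (f n) (g n) q.
have := enorm_dist_triangle (f n) p (g n); have := enorm_dist_triangle p q (g n).
rewrite (enormBC p (f n)) (enormBC q (g n)) ler_norml.
move=> *; apply/andP; split; lra.
Unshelve. all: by end_near. Qed.

(** By [dist_le_rho] the images form a Cauchy sequence of [K]. *)
Lemma rho_cauchy_limit x : rho_cauchy E a x ->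
  exists2 p, K p & (fun n => enorm (P (x n) - p)) @ \oo --> (0 : R).
Proof.
move=> xc.
have Pcvg : cvg ((P \o x) @ \oo).
  apply/cauchy_cvgP; apply: cauchy_exP => e e0.
  have eC : 0 < e / C by rewrite divr_gt0.
  have [N NP] := xc _ (powR_gt0 al^-1 eC).
  exists (P (x N)); exists N => // n /= Nn; rewrite -ball_normE /=.
  apply: le_lt_trans (norm_le_enorm _) _.
  apply: le_lt_trans (dist_le_rho _ _) _; rewrite mulrC -ltr_pdivlMr//.
  by apply: powR_lt (rho_ge0 _ _) (ltW eC) _; apply: NP.
exists (lim ((P \o x) @ \oo)).
  apply: (closed_cvg _ (compact_closed _ K_compact) _ _ Pcvg).
    exact: norm_hausdorff.
  by apply: nearW => n; exact: P_in_K.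
apply/ge0_cvg0P => [n|e e0]; first exact: enorm_ge0.
have ed : 0 < e / d.+1%:R by rewrite divr_gt0.
move/cvgrPdist_lt : Pcvg => /(_ _ ed); apply: filterS => n Pn.
apply: le_lt_trans (enorm_le_norm _) _; rewrite distrC.
apply: (@le_lt_trans _ _ (d.+1%:R * `|lim ((P \o x) @ \oo) - P (x n)|)).
  by rewrite ler_wpM2r// ler_nat.
by rewrite mulrC -ltr_pdivlMr.
Qed.

(** A set rather than a point: that all representatives of a boundary point have
the same limit is [bd_mapP]. *)
Definition bd_limits xi : set 'cV[R]_d :=
  [set p | exists2 y, xi y &
    (fun n => enorm (P (y n) - p)) @ \oo --> (0 : R)].

Definition bd_map xi : 'cV[R]_d := get (bd_limits xi).

Lemma bd_mapP xi y : boundary xi -> xi y ->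
  (fun n => enorm (P (y n) - bd_map xi)) @ \oo --> (0 : R).
Proof.
move=> bxi xiy; have [yc _ xiE] := boundary_representative bxi xiy.
have [p Kp yp] := rho_cauchy_limit yc.
have [z xiz zp] : bd_limits xi (bd_map xi).
  by apply: getPex; exists p, y.
have yz : (fun n => rho (y n) (z n)) @ \oo --> (0 : R).
  by move: xiz; rewrite xiE => -[].
have := enorm_cvg0_unique yp zp.
move=> /(cvg_unique _ (rho_cvg0_dist_cvg0 yz)) => /(_ (@norm_hausdorff _ _)) /esym.
by move/enorm0_eq0/subr0_eq => <-.
Qed.

Lemma bd_map_in_K xi : boundary xi -> K (bd_map xi).
Proof.
move=> bxi; have [y xiy] := boundary_nonempty bxi.
have [yc _ _] := boundary_representative bxi xiy.
have [p Kp yp] := rho_cauchy_limit yc.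
have := enorm_cvg0_unique yp (bd_mapP bxi xiy).
rewrite (_ : (fun n => _) = cst 0); last first.
  by apply/funext => n; rewrite subrr enorm0.
move=> /(cvg_unique _ (cvg_cst _)) => /(_ (@norm_hausdorff _ _)) /esym.
by move/enorm0_eq0/subr0_eq => <-.
Qed.

Lemma rho_limsupE x y : limn_sup (fun n => rho (x n) (y n))
  = inf (range (sups (fun n => rho (x n) (y n)))).
Proof.
apply: limn_supE; exists 1; split; first exact: num_real.
move=> M M1 n _ /=; rewrite ger0_norm ?rho_ge0//.
by apply: le_trans (rho_le_1 _ _) _; exact: ltW.
Qed.

Lemma rho_sups_ge x y n k : (n <= k)%N ->
  rho (x k) (y k) <= sups (fun n => rho (x n) (y n)) n.
Proof.
move=> nk; apply: ub_le_sup; first by exists 1 => _ [i _ <-].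
by exists k.
Qed.

Lemma rho_limsup_le x y t : (\forall n \near \oo, rho (x n) (y n) <= t) ->
  limn_sup (fun n => rho (x n) (y n)) <= t.
Proof.
case=> N _ NP; rewrite rho_limsupE.
apply: (@le_trans _ _ (sups (fun n => rho (x n) (y n)) N)).
  apply: ge_inf; last by exists N.
  by exists 0 => _ [n _ <-]; apply: le_trans (rho_ge0 _ _) (rho_sups_ge _ _ (leqnn n)).
by apply: ge_sup => [|_ [k Nk <-]]; [exists (rho (x N) (y N)), N => //=|exact: NP].
Qed.

Lemma rho_limsup_lt x y t : limn_sup (fun n => rho (x n) (y n)) < t ->
  \forall n \near \oo, rho (x n) (y n) < t.
Proof.
rewrite rho_limsupE => /inf_lt[|_ [N _ <-] Nt]; 
  first by exists (sups (fun n => rho (x n) (y n)) 0), 0%N.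
by exists N => // n Nn; apply: le_lt_trans Nt; exact: rho_sups_ge.
Qed.

Lemma rho_bd_ge xi eta x y : xi x -> eta y ->
  limn_sup (fun n => rho (x n) (y n)) <= rho_bd E a xi eta.
Proof.
move=> xix etay; apply: ub_le_sup; last by exists (x, y).
by exists 1 => _ [z _ <-]; apply: rho_limsup_le; exact: nearW.
Qed.

Lemma rho_bd_lt xi eta x y t : xi x -> eta y -> rho_bd E a xi eta < t ->
  \forall n \near \oo, rho (x n) (y n) < t.
Proof.
by move=> xix etay bt; apply/rho_limsup_lt/(le_lt_trans _ bt)/rho_bd_ge.
Qed.

Lemma rho_bd_le xi eta t : boundary xi -> boundary eta ->
  (forall x y, xi x -> eta y -> \forall n \near \oo, rho (x n) (y n) <= t) ->
  rho_bd E a xi eta <= t.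
Proof.
move=> /boundary_nonempty[x xix] /boundary_nonempty[y etay] le_t.
apply: ge_sup => [|_ [[x' y'] [/= xix' etay'] <-]].
  by exists (limn_sup (fun n => rho (x n) (y n))), (x, y).
exact/rho_limsup_le/le_t.
Qed.

Lemma rho_bd_ge0 xi eta : boundary xi -> boundary eta -> 0 <= rho_bd E a xi eta.
Proof.
move=> /boundary_nonempty[x xix] /boundary_nonempty[y etay].
rewrite leNgt; apply/negP => /(rho_bd_lt xix etay)[N _ /(_ N (leqnn N))] /=.
by rewrite ltNge rho_ge0.
Qed.

Lemma bd_map_dist_cvg xi eta x y : boundary xi -> boundary eta ->
  xi x -> eta y ->
  (fun n => enorm (P (x n) - P (y n))) @ \oo
    --> enorm (bd_map xi - bd_map eta).
Proof. by move=> bxi beta xix etay; apply: enorm_cvg0_unique; exact: bd_mapP. Qed.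

(** Along representatives, [rho] is eventually below any number greater than the
extended [rho], so [dist_le_rho] passes to the limit. *)
Lemma bd_map_dist_le xi eta : boundary xi -> boundary eta ->
  enorm (bd_map xi - bd_map eta) <= C * rho_bd E a xi eta `^ al.
Proof.
move=> bxi beta; rewrite leNgt; apply/negP => /midf_lt[]; set v := _ / _ => lv vl.
(* [v] is strictly between the two sides; [(v / C) `^ al^-1] is the value of
   [rho] at which the bound of [dist_le_rho] equals [v]. *)
have rb0 := rho_bd_ge0 bxi beta.
have vC : 0 <= v / C.
  by rewrite divr_ge0 ?(ltW C_gt0)// ltW// (le_lt_trans _ lv)// mulr_ge0 ?powR_ge0// ltW.
have bt : rho_bd E a xi eta < (v / C) `^ al^-1.
  by apply: lt_powR => //; rewrite ltr_pdivlMr// mulrC.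
have [x xix] := boundary_nonempty bxi; have [y etay] := boundary_nonempty beta.
have /filter_ex[n [vn]] : \forall n \near \oo,
    v < enorm (P (x n) - P (y n)) /\ rho (x n) (y n) < (v / C) `^ al^-1.
  near=> n; split; near: n; last exact: rho_bd_lt xix etay bt.
  exact: cvgr_gt (bd_map_dist_cvg bxi beta xix etay) _ vl.
move/(powR_lt (rho_ge0 _ _) vC); rewrite ltr_pdivlMr// mulrC => nv.
by have := lt_le_trans vn (dist_le_rho _ _); rewrite ltNge ltW.
Unshelve. all: by end_near. Qed.

(** The terms [r ^+ size _] of [rho_le_dist] tend to [0] along representatives
of boundary points. *)
Lemma rho_bd_le_dist xi eta : boundary xi -> boundary eta ->
  rho_bd E a xi eta `^ al <= C * enorm (bd_map xi - bd_map eta).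
Proof.
move=> bxi beta; rewrite leNgt; apply/negP => /midf_lt[]; set v := _ / _ => lv vl.
have v0 : 0 <= v by rewrite ltW// (le_lt_trans _ lv)// mulr_ge0 ?enorm_ge0// ltW.
have : v `^ al^-1 < rho_bd E a xi eta.
  rewrite ltNge; apply/negP => bv; move: vl; rewrite ltNge => /negP; apply.
  rewrite -[leRHS](powRr1 v0) -(mulVf al_neq0) powRrM.
  by apply: ge0_ler_powR; rewrite ?nnegrE ?powR_ge0 ?rho_bd_ge0// ltW.
rewrite ltNge => /negP; apply; apply: rho_bd_le => // x y xix etay.
have [_ xoo _] := boundary_representative bxi xix.
have [_ yoo _] := boundary_representative beta etay.
have bound_cvg : (fun n => C * (enorm (P (x n) - P (y n)) + r ^+ size (x n)
    + r ^+ size (y n))) @ \oo --> C * enorm (bd_map xi - bd_map eta).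
  apply: cvgM; first exact: cvg_cst.
  have := cvgD (cvgD (bd_map_dist_cvg bxi beta xix etay) (escapes_expr_cvg0 xoo))
    (escapes_expr_cvg0 yoo).
  by rewrite !addr0; apply.
near=> n; apply/ltW/lt_powR => //; first exact: rho_ge0.
apply: le_lt_trans (rho_le_dist _ _) _; near: n; exact: cvgr_lt bound_cvg _ lv.
Unshelve. all: by end_near. Qed.

(** Boundary points with the same image are at [rho]-distance [0], so that their
representatives are equivalent. *)
Lemma bd_map_inj : set_inj boundary bd_map.
Proof.
move=> xi eta /set_mem bxi /set_mem beta eq_map.
have := rho_bd_le_dist bxi beta; rewrite eq_map subrr enorm0 mulr0 => le0.
have bd0 : rho_bd E a xi eta = 0.
  by apply: (@powR_eq0_eq0 _ _ al); apply/eqP; rewrite eq_le le0 powR_ge0.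
have [x xix] := boundary_nonempty bxi; have [y etay] := boundary_nonempty beta.
have [_ _ ->] := boundary_representative bxi xix.
have [_ _ ->] := boundary_representative beta etay.
apply/cauchy_class_eq/ge0_cvg0P => [n|e e0]; first exact: rho_ge0.
by apply: rho_bd_lt xix etay _; rewrite bd0.
Qed.

(** By [rho_le_dist], words whose images approximate [p] and whose sizes tend to
infinity form a Cauchy sequence, whether or not they are prefixes of each
other. *)
Lemma bd_map_surj (M : R) : 0 < M ->
  (forall p n, K p -> exists2 u, size u = n & enorm (P u - p) <= r ^+ n * M) ->
  set_surj boundary K bd_map.
Proof.
move=> M0 approx p Kp.
have /choice[x xP] n : exists u, size u = n /\ enorm (P u - p) <= r ^+ n * M.
  by have [u ? ?] := approx p n Kp; exists u.
have xoo : escapes x by move=> n; exists n => // i /=; rewrite (xP i).1.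
have xp : (fun n => enorm (P (x n) - p)) @ \oo --> (0 : R).
  apply/ge0_cvg0P => [n|e e0]; first exact: enorm_ge0.
  have [N NP] := expr_lt_eventually r_gt0 r_lt1 (divr_gt0 e0 M0).
  exists N => // n /NP rn; apply: le_lt_trans (xP n).2 _.
  by rewrite -ltr_pdivlMr.
have xc : rho_cauchy E a x.
  (* With [r ^+ i, r ^+ j < t], each of the two indices contributes less than
     [t * (M + 1)] to the sum in [rho_le_dist]: [M] for the distance to [p] and
     [1] for the term [r ^+ size _]. *)
  move=> e e0; pose t := e `^ al / C / (2 * (M + 1)).
  have t0 : 0 < t.
    by rewrite !divr_gt0 ?powR_gt0// mulr_gt0// addr_gt0.
  have [N NP] := expr_lt_eventually r_gt0 r_lt1 t0.
  exists N => i j Ni Nj.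
  have ri := NP i Ni; have rj := NP j Nj.
  have : rho (x i) (x j) `^ al < e `^ al.
    apply: le_lt_trans (rho_le_dist _ _) _.
    rewrite mulrC -ltr_pdivlMr// (xP i).1 (xP j).1.
    have -> : e `^ al / C = t * (M + 1) + t * (M + 1).
      by rewrite -mulrDr -mulr2n -mulr_natl /t divfK// gt_eqF// mulr_gt0// addr_gt0.
    apply: (@le_lt_trans _ _ (r ^+ i * (M + 1) + r ^+ j * (M + 1))).
      have := enorm_dist_triangle (P (x i)) p (P (x j)).
      have := (xP i).2; have := (xP j).2; rewrite (enormBC _ p).
      set D := enorm (_ - P (x j)); set D' := enorm _ ; set D2 := enorm _.
      by move=> *; rewrite !mulrDr; lra.
    by rewrite ltrD// ltr_pM2r// addr_gt0.
  move=> lt_al; rewrite ltNge; apply/negP => le_e.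
  move: lt_al; rewrite ltNge => /negP; apply.
  by apply: ge0_ler_powR; rewrite ?nnegrE ?rho_ge0 ?(ltW e0) ?(ltW al_gt0).
have bx := escapes_boundary xc xoo.
have xx : cauchy_class E a x x by split=> //; exact: rho_cvg0_refl.
exists (cauchy_class E a x) => //.
have := enorm_cvg0_unique (bd_mapP bx xx) xp.
rewrite (_ : (fun n => _) = cst 0); last first.
  by apply/funext => n; rewrite subrr enorm0.
move=> /(cvg_unique _ (cvg_cst _)) => /(_ (@norm_hausdorff _ _)) /esym.
by move/enorm0_eq0/subr0_eq.
Qed.

Lemma bd_map_hoelder (M : R) : 0 < M ->
  (forall p n, K p -> exists2 u, size u = n & enorm (P u - p) <= r ^+ n * M) ->
  set_bij boundary K bd_map /\
  forall xi eta, boundary xi -> boundary eta ->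
    C^-1 * enorm (bd_map xi - bd_map eta) <= rho_bd E a xi eta `^ al
      <= C * enorm (bd_map xi - bd_map eta).
Proof.
move=> M0 approx; split=> [|xi eta bxi beta].
  split; [exact: bd_map_in_K|exact: bd_map_inj|exact: bd_map_surj M0 approx].
by rewrite rho_bd_le_dist// mulrC ler_pdivrMr// mulrC bd_map_dist_le.
Qed.

End BoundaryMap.

(** * Boundary and self-similar set *)

Theorem proposition3p5 (R : realType) (d m : nat)
    (r : R) (Q : 'I_m -> 'M[R]_d) (b : 'I_m -> 'cV[R]_d)
    (S : 'I_m -> 'cV[R]_d -> 'cV[R]_d) (K J : set 'cV[R]_d) (delta a : R)
    (r_gt0 : 0 < r) (r_lt1 : r < 1)
    (Q_orthogonal : forall i, (Q i)^T *m Q i = 1%:M)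
    (S_similitude : forall i x, S i x = r *: (Q i *m x) + b i)
    (K_self_similar : self_similar_set S K)
    (K_condH : condH S r K)
    (J_invariant : bounded_closed_invariant S J)
    (X_simple : simple_tree (@vedge m) (hedge S J))
    (X_hyperbolic : hyperbolic (edge S J) delta)
    (a_gt0 : 0 < a) (a_small : expR (delta * a) - 1 < Num.sqrt 2 - 1) :
  exists Phi : set (nat -> word m) -> 'cV[R]_d,
    set_bij (boundary (edge S J) a) K Phi /\
    exists2 C : R, 0 < C &
      forall xi eta, boundary (edge S J) a xi -> boundary (edge S J) a eta ->
        C^-1 * enorm (Phi xi - Phi eta)
          <= rho_bd (edge S J) a xi eta `^ (- ln r / a)
          <= C * enorm (Phi xi - Phi eta).
Proof.
have [[p Kp] K_compact _] := K_self_similar.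
have K_inv := self_similar_invariant K_self_similar.
have H_sym := hedge_sym S J; have H_size := @hedge_size _ _ _ S J.
have al_gt0 : 0 < - ln r / a.
  by rewrite divr_gt0// oppr_gt0 ln_lt0// r_gt0.
have [C C0 comparison] := rho_comparison r_gt0 r_lt1 Q_orthogonal S_similitude
  K_self_similar K_condH J_invariant X_simple a_gt0 Kp.
have [M M0 KM] := bounded_enorm (compact_bounded K_compact).
have approx q n : K q ->
    exists2 u, size u = n & enorm (Sword S u p - q) <= r ^+ n * M.
  move=> Kq; have [u un [s Ks <-]] := self_similar_cells K_self_similar n Kq.
  exists u; rewrite // (enorm_Sword r_gt0 Q_orthogonal S_similitude) un.
  by rewrite ler_wpM2l ?KM// exprn_ge0// ltW.
have [bij hoelder] := bd_map_hoelder (E := edge S J) al_gt0 r_gt0 r_lt1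
  (expR_gt0 (a * delta)) C0 (rho_sym H_sym a)
  (fun u v => rho_le1 H_sym H_size u v a_gt0)
  (fun u v => rho_ge_size H_sym H_size a_gt0)
  (fun u v w => rho_quasi_ultrametric u v w a_gt0 X_hyperbolic)
  a_gt0 (fun u v => (comparison u v).1) (fun u v => (comparison u v).2)
  K_compact (fun u => Sword_invariant K_inv u Kp) M0 approx.
by exists (bd_map (fun u => Sword S u p)); split=> //; exists C.
Qed.
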